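(* Let $\varphi$ be a classical solution to the Robin boundary problem $$\begin{cases}(\partial_t+\mathcal{L}^0)\varphi(t,\mathbf{x})=\rho\,\varphi(t,\mathbf{x}), & (t,\mathbf{x})\in[0,T)\times\mathbb{R}_+^d,\\ \varphi(T,\mathbf{x})=0, & \mathbf{x}\in\overline{\mathbb{R}}_+^d,\\ \partial_{x_i}\varphi(t,(\mathbf{x}^{-i},0))+c_i\,\varphi(t,(\mathbf{x}^{-i},0))=f_i(t,\mathbf{x}^{-i}), & (t,\mathbf{x}^{-i})\in[0,T)\times\overline{\mathbb{R}}_+^{d-1},\ i=1,\dots,d.\end{cases}$$ Given this $\varphi$, let $\psi$ be a classical solution to the Robin boundary problem $$\begin{cases}(\partial_t+\mathcal{L})\psi(t,\mathbf{x})=\rho\,\psi(t,\mathbf{x})-\dfrac12\displaystyle\sum_{i\ne j}\Big(\sum_{k=1}^m\sigma_{ik}\sigma_{jk}\Big)\partial^2_{x_ix_j}\varphi(t,\mathbf{x}), & (t,\mathbf{x})\in[0,T)\times\mathbb{R}_+^d,\\ \psi(T,\mathbf{x})=g(\mathbf{x}), & \mathbf{x}\in\overline{\mathbb{R}}_+^d,\\ \partial_{x_i}\psi(t,(\mathbf{x}^{-i},0))+c_i\,\psi(t,(\mathbf{x}^{-i},0))=0, & (t,\mathbf{x}^{-i})\in[0,T)\times\overline{\mathbb{R}}_+^{d-1},\ i=1,\dots,d.\end{cases}$$ Then $u=\varphi+\psi$ is a classical solution to the Robin boundary problem $$\begin{cases}(\partial_t+\mathcal{L})u(t,\mathbf{x})=\rho\,u(t,\mathbf{x}),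 & (t,\mathbf{x})\in[0,T)\times\mathbb{R}_+^d,\\ u(T,\mathbf{x})=g(\mathbf{x}), & \mathbf{x}\in\overline{\mathbb{R}}_+^d,\\ \partial_{x_i}u(t,(\mathbf{x}^{-i},0))+c_i\,u(t,(\mathbf{x}^{-i},0))=f_i(t,\mathbf{x}^{-i}), & (t,\mathbf{x}^{-i})\in[0,T)\times\overline{\mathbb{R}}_+^{d-1},\ i=1,\dots,d.\end{cases}$$
   Context: Notation: $\mathbb{R}_+=(0,\infty)$, $\overline{\mathbb{R}}_+=[0,\infty)$. For $\mathbf{x}=(x_1,\dots,x_d)$, $\mathbf{x}^{-i}$ is the vector in $\mathbb{R}^{d-1}$ obtained by deleting $x_i$, and $(\mathbf{x}^{-i},0)=(x_1,\dots,x_{i-1},0,x_{i+1},\dots,x_d)$. Data: $d\ge2$ and $m\ge1$ are integers, $\rho\ge0$, $T>0$, $(c_1,\dots,c_d)\in\mathbb{R}^d$, $\mu_i\in\mathbb{R}$ for $i=1,\dots,d$, and $(\sigma_{ik})$ is a real $d\times m$ matrix such that $(\sum_{k=1}^m\sigma_{ik}\sigma_{jk})_{i,j=1}^d$ is positive definite. For $\phi\in C^2(\mathbb{R}_+^d)$, $$\mathcal{L}\phi=\frac12\sum_{i,j=1}^d\Big(\sum_{k=1}^m\sigma_{ik}\sigma_{jk}\Big)\partial^2_{x_ix_j}\phi+\sum_{i=1}^d\mu_i\,\partial_{x_i}\phi,\qquad \mathcal{L}^0\phi=\frac12\sum_{i=1}^d\Big(\sum_{k=1}^m\sigma_{ik}^2\Big)\partial^2_{x_i}\phi+\sum_{i=1}^d\mu_i\,\partial_{x_i}\phi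 .$$ Standing assumption: $g\in C^2(\overline{\mathbb{R}}_+^d)$ and $f_i\in C^{1,2}([0,T]\times\overline{\mathbb{R}}_+^{d-1})$ for $i=1,\dots,d$; there exist $C>0$ and $q\ge1$ such that $g$ and the functions $f_i(t,\cdot)$ ($t\in[0,T]$, $i=1,\dots,d$), together with all their first- and second-order partial derivatives in the spatial variables, are bounded in absolute value by $C(1+|\cdot|^q)$ at every point of their spatial domain. Classical solution: a function in $C^{1,2}([0,T)\times\mathbb{R}_+^d)\cap C([0,T]\times\overline{\mathbb{R}}_+^d)$ which solves the stated problem (equation, terminal condition and boundary conditions). *)

(* Defs.v *)
From HB Require Import structures.
From mathcomp Require Import all_boot all_order all_algebra.
From mathcomp Require Import all_classical all_reals all_analysis.

Set Implicit Arguments.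
Unset Strict Implicit.
Unset Printing Implicit Defensive.

Import Order.TTheory GRing.Theory Num.Theory.
Import numFieldNormedType.Exports.
Local Open Scope classical_set_scope.
Local Open Scope ring_scope.

Section derive_within.
Context {R : realType} {V W : normedModType R}.
Implicit Types (D : set V) (f : V -> W).

(* [derive] and [derivable] with increments restricted to those staying in D:
   one-sided derivatives when [a] lies on the boundary of D. *)
Definition derive_within D f (a v : V) : W :=
  lim ((fun h : R => h^-1 *: ((f \o shift a) (h *: v) - f a)) @
       within [set h | D (h *: v + a)] 0^').

Definition derivable_within D f (a v : V) : Prop :=
  cvg ((fun h : R => h^-1 *: ((f \o shift a) (h *: v) - f a)) @
       within [set h | D (h *: v + a)] 0^').

Let within_open D (a v : V) : open D -> D a ->
  within [set h : R | D (h *: v + a)] 0^' = 0^'.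
Proof.
move=> oD Da; have nD : \forall h \near (0 : R)^', D (h *: v + a).
  apply: nbhs_dnbhs; have : (fun h : R => h *: v + a) @ (0 : R) --> 0 *: v + a.
    by apply: cvgD; [apply: cvgZr_tmp; exact: cvg_id|exact: cvg_cst].
  by apply; rewrite scale0r add0r; exact: open_nbhs_nbhs.
apply/seteqP; split => A; rewrite /within/= => hA; last first.
  by apply: filterS hA => h ? _.
by apply: filterS2 nD hA => h Dh; exact.
Qed.

Lemma derive_withinE D f a v : open D -> D a ->
  derive_within D f a v = 'D_v f a.
Proof. by move=> oD Da; rewrite /derive_within within_open. Qed.

Lemma derivable_withinE D f a v : open D -> D a ->
  derivable_within D f a v = derivable f a v.
Proof. by move=> oD Da; rewrite /derivable_within within_open. Qed.

End derive_within.

Section orthant.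
Context {R : realType}.

Definition orthant (n : nat) : set 'rV[R]_n :=
  [set x | forall i, 0 < x ord0 i].

Definition closed_orthant (n : nat) : set 'rV[R]_n :=
  [set x | forall i, 0 <= x ord0 i].

(* (x^{-i}, 0); the vector x^{-i} itself is [col' i x]. *)
Definition face_point (n : nat) (i : 'I_n) (x : 'rV[R]_n) : 'rV[R]_n :=
  \row_j (if j == i then 0 else x ord0 j).

(* The library norm on ['rV[R]_n] is the sup norm. *)
Definition enorm (n : nat) (x : 'rV[R]_n) : R :=
  Num.sqrt (\sum_i x ord0 i ^+ 2).

End orthant.

Section regularity.
Context {R : realType} {n : nat}.
Implicit Types (X : set 'rV[R]_n) (h : 'rV[R]_n -> R) (I : set R)
  (u : R -> 'rV[R]_n -> R).

Definition partial_derivable X i h (x : 'rV[R]_n) : Prop :=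
  derivable_within X h x (delta_mx 0 i).

Definition partial X i h (x : 'rV[R]_n) : R :=
  derive_within X h x (delta_mx 0 i).

Definition twice_derivable X h : Prop :=
  forall x, X x ->
    (forall i, partial_derivable X i h x) /\
    (forall i j, partial_derivable X i (partial X j h) x).

Definition C2 X h : Prop :=
  [/\ twice_derivable X h,
      {within X, continuous h},
      forall i, {within X, continuous (partial X i h)} &
      forall i j, {within X, continuous (partial X i (partial X j h))}].

Definition partial_t I u (t : R) (x : 'rV[R]_n) : R :=
  derive_within I (u^~ x) t 1.

Definition continuous_tx I X u : Prop :=
  {within I `*` X, continuous (fun p : R * 'rV[R]_n => u p.1 p.2)}.

Definition C12 I X u : Prop :=
  [/\ forall t x, I t -> X x -> derivable_within I (u^~ x) t 1,
      forall t, I t -> twice_derivable X (u t),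
      continuous_tx I X u,
      continuous_tx I X (partial_t I u) &
      (forall i, continuous_tx I X (fun t => partial X i (u t))) /\
      (forall i j,
        continuous_tx I X (fun t => partial X i (partial X j (u t))))].

Definition poly_growth2 (C q : R) X h : Prop :=
  forall x, X x ->
    [/\ `|h x| <= C * (1 + enorm x `^ q),
        forall i, `|partial X i h x| <= C * (1 + enorm x `^ q) &
        forall i j, `|partial X i (partial X j h) x|
                      <= C * (1 + enorm x `^ q)].

End regularity.

Section operators.
Context {R : realType} {d m : nat}.
Implicit Types (sigma : 'M[R]_(d, m)) (mu : 'I_d -> R) (h : 'rV[R]_d -> R).

Definition cov sigma : 'M[R]_d :=
  \matrix_(i, j) \sum_k sigma i k * sigma j k.

Definition posdef (A : 'M[R]_d) : Prop :=
  forall x : 'rV[R]_d, x != 0 -> 0 < (x *m A *m x^T) ord0 ord0.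

Definition L sigma mu h (x : 'rV[R]_d) : R :=
  2^-1 * (\sum_i \sum_j
    cov sigma i j * partial (@orthant R d) i (partial (@orthant R d) j h) x)
  + \sum_i mu i * partial (@orthant R d) i h x.

Definition L0 sigma mu h (x : 'rV[R]_d) : R :=
  2^-1 * (\sum_i
    (\sum_k sigma i k ^+ 2) *
      partial (@orthant R d) i (partial (@orthant R d) i h) x)
  + \sum_i mu i * partial (@orthant R d) i h x.

Definition mixed_part sigma h (x : 'rV[R]_d) : R :=
  2^-1 * (\sum_i \sum_(j | i != j)
    cov sigma i j * partial (@orthant R d) i (partial (@orthant R d) j h) x).

End operators.

Section robin.
Context {R : realType} {d : nat}.
Implicit Types (T : R) (A : ('rV[R]_d -> R) -> 'rV[R]_d -> R)
  (rhs u : R -> 'rV[R]_d -> R) (term : 'rV[R]_d -> R) (c : 'I_d -> R)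
  (b : 'I_d -> R -> 'rV[R]_d.-1 -> R).

(* (d_t + A) u = rhs *)
Definition solves_pde T A rhs u : Prop :=
  forall t x, 0 <= t < T -> orthant x ->
    partial_t `[0, T[ u t x + A (u t) x = rhs t x.

Definition terminal_condition T term u : Prop :=
  forall x, closed_orthant x -> u T x = term x.

(* At a boundary point the normal derivative is the one-sided derivative of
   u(t, .) on the closed orthant; its existence is part of the condition,
   since [lim] is total. *)
Definition robin_condition T c b u : Prop :=
  forall t (x : 'rV[R]_d) i, 0 <= t < T -> closed_orthant (col' i x) ->
    partial_derivable (@closed_orthant R d) i (u t) (face_point i x) /\
    partial (@closed_orthant R d) i (u t) (face_point i x)
      + c i * u t (face_point i x) = b i t (col' i x).

Definition classical_solution T A rhs term c b u : Prop :=
  [/\ C12 `[0, T[ (@orthant R d) u,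
      continuous_tx `[0, T] (@closed_orthant R d) u,
      solves_pde T A rhs u,
      terminal_condition T term u &
      robin_condition T c b u].

End robin.

(* Main.v *)
Require Import Defs.
From HB Require Import structures.
From mathcomp Require Import all_boot all_order all_algebra.
From mathcomp Require Import all_classical all_reals all_analysis.

Set Implicit Arguments.
Unset Strict Implicit.
Unset Printing Implicit Defensive.

Import Order.TTheory GRing.Theory Num.Theory.
Import numFieldNormedType.Exports.
Local Open Scope classical_set_scope.
Local Open Scope ring_scope.

(** The operators [L] and [L0] differ exactly by the mixed part, so the source
    term of the problem for [psi] cancels the defect of [phi]; the rest is
    linearity. Linearity of the one-sided derivatives requires uniqueness of
    limits along the increments that stay in the domain, which holds because
    each domain contains a small segment in every positive direction. *)

Section derive_within_sum.
Context {R : realType} {V W : normedModType R}.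
Implicit Types (D : set V) (f g : V -> W) (a v : V).

(* Limits are unique only along proper filters; the latter hold as soon as [D]
   contains a right half-segment issued from [a]. *)
Lemma within_ray_proper D a v :
  (\forall h \near (0 : R)^'+, D (h *: v + a)) ->
  ProperFilter (within [set h : R | D (h *: v + a)] 0^').
Proof.
move=> Dav; apply: (@Build_ProperFilter_ex _ _ _ (within_filter _ _)) => A hA.
(* A positive increment is nonzero, so a property holding on a punctured neighbourhood of 0 holds in
   particular to its right. *)
have {}hA : \forall h \near (0 : R)^'+, D (h *: v + a) -> A h.
  rewrite /prop_near1 /nbhs/= /at_right /within/=.
  have {}hA : \forall h \near (0 : R), h != 0 -> D (h *: v + a) -> A h by [].
  by apply: filterS hA => h hA h0; apply: hA; rewrite gt_eqF.
have {}hA : \forall h \near (0 : R)^'+, A h.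
  by apply: filterS2 Dav hA => h Dh; exact.
exact: (@filter_ex _ _ (at_right_proper_filter 0)).
Qed.

(** The filter only sees increments that stay in [D], and the base point is in [D] too, so values
    outside [D] never enter the quotient. *)
Let quotient_within_eq D f g a v : {in D, f =1 g} -> D a ->
  (fun h : R => h^-1 *: ((f \o shift a) (h *: v) - f a)) @
     within [set h | D (h *: v + a)] 0^' =
  (fun h : R => h^-1 *: ((g \o shift a) (h *: v) - g a)) @
     within [set h | D (h *: v + a)] 0^'.
Proof.
move=> fg Da; have fg' : {near within [set h : R | D (h *: v + a)] 0^',
    (fun h : R => h^-1 *: ((f \o shift a) (h *: v) - f a)) =1
    (fun h : R => h^-1 *: ((g \o shift a) (h *: v) - g a))}.
  rewrite /prop_near1 /within /=; apply: nearW => h Dh.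
  by rewrite !fg ?inE.
apply/seteqP; split; apply: near_eq_cvg => //.
by apply: filterS fg' => h ->.
Qed.

Lemma eq_derive_within D f g a v : {in D, f =1 g} -> D a ->
  derive_within D f a v = derive_within D g a v.
Proof. by move=> fg Da; rewrite /derive_within (quotient_within_eq _ fg). Qed.

Lemma eq_derivable_within D f g a v : {in D, f =1 g} -> D a ->
  derivable_within D f a v = derivable_within D g a v.
Proof. by move=> fg Da; rewrite /derivable_within (quotient_within_eq _ fg). Qed.

Let quotientD f g a v :
  (fun h : R => h^-1 *: (((fun x => f x + g x) \o shift a) (h *: v)
                          - (f a + g a))) =
  (fun h : R => h^-1 *: ((f \o shift a) (h *: v) - f a)
              + h^-1 *: ((g \o shift a) (h *: v) - g a)).
Proof. by apply/funext => h /=; rewrite -scalerDr opprD addrACA. Qed.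

Lemma derivable_withinD D f g a v :
  derivable_within D f a v -> derivable_within D g a v ->
  derivable_within D (fun x => f x + g x) a v.
Proof.
by move=> df dg; rewrite /derivable_within quotientD; exact: is_cvgD.
Qed.

(** The ray hypothesis makes the filter proper, hence limits unique, so that [lim] commutes with the
    sum. *)
Lemma derive_withinD D f g a v : (\forall h \near (0 : R)^'+, D (h *: v + a)) ->
  derivable_within D f a v -> derivable_within D g a v ->
  derive_within D (fun x => f x + g x) a v =
  derive_within D f a v + derive_within D g a v.
Proof.
move=> /within_ray_proper pF df dg.
by rewrite /derive_within quotientD limD.
Qed.

End derive_within_sum.

Section regularity_sum.
Context {R : realType} {n : nat}.
Implicit Types (X : set 'rV[R]_n) (h k : 'rV[R]_n -> R) (I : set R)
  (u w : R -> 'rV[R]_n -> R).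

(** Shared by the open orthant, where the equation holds, and the closed one, where the boundary
    condition is read. *)
Definition ray_stable X : Prop :=
  forall x i, X x -> \forall e \near (0 : R)^'+, X (e *: delta_mx 0 i + x).

Lemma orthant_ray : ray_stable (@orthant R n).
Proof.
move=> x i x0; near=> e => j; rewrite !mxE.
by rewrite ltr_wpDl// mulr_ge0.
Unshelve. all: by end_near. Qed.

Lemma closed_orthant_ray : ray_stable (@closed_orthant R n).
Proof.
move=> x i x0; near=> e => j; rewrite !mxE.
by rewrite addr_ge0// mulr_ge0.
Unshelve. all: by end_near. Qed.

Lemma partialD X i h k x : ray_stable X -> X x ->
  partial_derivable X i h x -> partial_derivable X i k x ->
  partial X i (fun y => h y + k y) x = partial X i h x + partial X i k x.
Proof. by move=> rX Xx; apply: derive_withinD; exact: rX. Qed.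

Lemma partial_partialD X i j h k x : ray_stable X -> X x ->
  twice_derivable X h -> twice_derivable X k ->
  partial X i (partial X j (fun y => h y + k y)) x =
  partial X i (partial X j h) x + partial X i (partial X j k) x.
Proof.
move=> rX Xx dh dk; rewrite -partialD//.
(* The inner partial derivative is known to be additive only on [X], which is all that the outer one
   depends on. *)
- apply: eq_derive_within => // y /set_mem Xy.
  by apply: partialD => //; [exact: (dh y Xy).1|exact: (dk y Xy).1].
- exact: (dh x Xx).2.
- exact: (dk x Xx).2.
Qed.

Lemma twice_derivableD X h k : ray_stable X ->
  twice_derivable X h -> twice_derivable X k ->
  twice_derivable X (fun y => h y + k y).
Proof.
move=> rX dh dk x Xx; split=> [i|i j].
  by apply: derivable_withinD; [exact: (dh x Xx).1|exact: (dk x Xx).1].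
rewrite /partial_derivable.
rewrite (@eq_derivable_within _ _ _ _ _
  (fun y => partial X j h y + partial X j k y))//.
  by apply: derivable_withinD; [exact: (dh x Xx).2|exact: (dk x Xx).2].
move=> y /set_mem Xy.
by apply: partialD => //; [exact: (dh y Xy).1|exact: (dk y Xy).1].
Qed.

Lemma continuous_txD I X u w : continuous_tx I X u -> continuous_tx I X w ->
  continuous_tx I X (fun t x => u t x + w t x).
Proof. by move=> cu cw p; apply: cvgD; [exact: cu|exact: cw]. Qed.

Lemma eq_continuous_tx I X u w : (forall t x, I t -> X x -> u t x = w t x) ->
  continuous_tx I X u -> continuous_tx I X w.
Proof.
move=> uw; apply: subspace_eq_continuous => -[t x] /set_mem[/= It Xx].
exact: uw.
Qed.

Lemma partial_tD I u w t x : (\forall e \near (0 : R)^'+, I (e + t)) ->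
  derivable_within I (u^~ x) t 1 -> derivable_within I (w^~ x) t 1 ->
  partial_t I (fun s y => u s y + w s y) t x =
  partial_t I u t x + partial_t I w t x.
Proof.
move=> It; apply: derive_withinD.
by apply: filterS It => e; rewrite /GRing.scale/= mulr1.
Qed.

(** On [I] times [X] each derivative of the sum is the sum of the derivatives, and continuity within
    this product depends only on the values there. *)
Lemma C12D I X u w : ray_stable X ->
  (forall t, I t -> \forall e \near (0 : R)^'+, I (e + t)) ->
  C12 I X u -> C12 I X w -> C12 I X (fun t x => u t x + w t x).
Proof.
move=> rX rI [ut ux uc utc [u1 u2]] [wt wx wc wtc [w1 w2]]; split.
- by move=> t x It Xx; apply: derivable_withinD; [exact: ut|exact: wt].
- by move=> t It; apply: twice_derivableD; [|exact: ux|exact: wx].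
- exact: continuous_txD.
- apply: eq_continuous_tx (continuous_txD utc wtc) => t x It Xx.
  by rewrite partial_tD//; [exact: rI|exact: ut|exact: wt].
split=> [i|i j].
  apply: eq_continuous_tx (continuous_txD (u1 i) (w1 i)) => t x It Xx.
  by rewrite partialD//; [exact: (ux t It x Xx).1|exact: (wx t It x Xx).1].
apply: eq_continuous_tx (continuous_txD (u2 i j) (w2 i j)) => t x It Xx.
by rewrite partial_partialD//; [exact: ux|exact: wx].
Qed.

End regularity_sum.

(** The interval is open on the right, so every point, the left endpoint included, has room after
    it. *)
Lemma itvco_ray (R : realType) (a b t : R) : `[a, b[%classic t ->
  \forall e \near (0 : R)^'+, `[a, b[%classic (e + t).
Proof.
rewrite /= in_itv/= => /andP[ta tb]; near=> e; rewrite /= in_itv/=.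
apply/andP; split; first by rewrite ler_wpDl.
by rewrite -ltrBrDr; near: e; apply: nbhs_right_lt; rewrite subr_gt0.
Unshelve. all: by end_near. Qed.

Section operators_sum.
Context {R : realType} {d m : nat} (sigma : 'M[R]_(d, m)) (mu : 'I_d -> R).
Implicit Types (h k : 'rV[R]_d -> R).

Lemma LE h x : L sigma mu h x = L0 sigma mu h x + mixed_part sigma h x.
Proof.
rewrite /L /L0 /mixed_part addrAC -mulrDr -big_split/=.
congr (_ * _ + _); apply: eq_bigr => i _.
(* The term [j = i] carries the diagonal entry of [cov sigma], the sum of the squares
   [sigma i k ^+ 2]; the other terms form the mixed part. *)
rewrite (bigD1 i)//= mxE; congr (_ * _ + _).
by apply: eq_bigl => j; rewrite eq_sym.
Qed.

Lemma LD h k x : orthant x ->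
  twice_derivable (@orthant R d) h -> twice_derivable (@orthant R d) k ->
  L sigma mu (fun y => h y + k y) x = L sigma mu h x + L sigma mu k x.
Proof.
move=> x0 dh dk; rewrite /L addrACA -mulrDr -!big_split/=.
congr (_ * _ + _); apply: eq_bigr => i _.
  rewrite -big_split/=; apply: eq_bigr => j _.
  by rewrite partial_partialD ?mulrDr//; exact: orthant_ray.
rewrite partialD ?mulrDr//; first exact: orthant_ray.
  exact: (dh x x0).1.
exact: (dk x x0).1.
Qed.

End operators_sum.

Lemma face_point_closed_orthant (R : realType) (d : nat) (i : 'I_d)
  (x : 'rV[R]_d) :
  closed_orthant (col' i x) -> closed_orthant (face_point i x).
Proof.
move=> x0 j; rewrite mxE; have [//|ji] := eqVneq j i.
(* A coordinate other than [i] survives in [col' i x], at the index [k] with [j = lift i k]. *)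
have [k jk _] : {k | j = lift i k & unlift i j = Some k}.
  by apply: unlift_some; rewrite eq_sym.
by have := x0 k; rewrite mxE -jk.
Qed.

Theorem lemma2p1 (R : realType) (d m : nat) (hd : (2 <= d)%N) (hm : (1 <= m)%N)
  (rho T : R) (hrho : 0 <= rho) (hT : 0 < T)
  (c mu : 'I_d -> R) (sigma : 'M[R]_(d, m)) (hsigma : posdef (cov sigma))
  (g : 'rV[R]_d -> R) (f : 'I_d -> R -> 'rV[R]_d.-1 -> R)
  (hg : C2 (@closed_orthant R d) g)
  (hf : forall i, C12 `[0, T] (@closed_orthant R d.-1) (f i))
  (hgrowth : exists C q : R, [/\ 0 < C, 1 <= q,
     poly_growth2 C q (@closed_orthant R d) g &
     forall i t, 0 <= t <= T ->
       poly_growth2 C q (@closed_orthant R d.-1) (f i t)])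
  (phi psi : R -> 'rV[R]_d -> R)
  (hphi : classical_solution T (L0 sigma mu)
     (fun t x => rho * phi t x) (fun=> 0) c f phi)
  (hpsi : classical_solution T (L sigma mu)
     (fun t x => rho * psi t x - mixed_part sigma (phi t) x)
     g c (fun _ _ _ => 0) psi) :
  let u := fun t x => phi t x + psi t x in
  classical_solution T (L sigma mu) (fun t x => rho * u t x) g c f u.
Proof.
move=> u.
case: hphi => phi12 phic phiE phiT phiR; case: hpsi => psi12 psic psiE psiT psiR.
split.
- by apply: C12D => //; [exact: orthant_ray|move=> t; exact: itvco_ray].
- exact: continuous_txD.
- move=> t x tT x0.
  have It : `[0, T[%classic t by rewrite /= in_itv.
  have [phit phix _ _ _] := phi12; have [psit psix _ _ _] := psi12.
  rewrite partial_tD; [|exact: itvco_ray|exact: phit|exact: psit].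
  rewrite LD//; [|exact: phix|exact: psix].
  (* Writing [L] on [phi] as [L0] plus the mixed part produces [mixed_part sigma (phi t) x], which
     cancels the source term in the equation for [psi]. *)
  rewrite addrACA psiE// LE [_ + (L0 _ _ _ _ + _)]addrA phiE// /u mulrDr.
  by rewrite addrACA subrr addr0.
- by move=> x x0; rewrite /u phiT// psiT// add0r.
- move=> t x i tT x0.
  have [dphi phiB] := phiR t x i tT x0; have [dpsi psiB] := psiR t x i tT x0.
  split; first exact: derivable_withinD.
  (* The normal derivative is additive at the face point, and the boundary data [f i] and 0 add up
     to [f i]. *)
  rewrite partialD//; first by rewrite /u mulrDr addrACA phiB psiB addr0.
    exact: closed_orthant_ray.
  exact: face_point_closed_orthant.
Qed.
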